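(* Let $\bar\lambda>0$, let $(\beta_k)$ be positive step sizes, $(\lambda_k)$ positive monotonically increasing penalty parameters, and let $(x_k)$ be generated by $$x_{k+1}=x_k-\beta_k\nabla_x\big[f(x_k,\boldsymbol y^k)+\lambda_kg(x_k,\boldsymbol y^k)\big],\qquad k=0,1,2,\dots$$ with i.i.d. samples $\boldsymbol y^k\sim\mu$. Assume that: (i) there is $a>0$ with $\mathbb E_{\boldsymbol y}[g(x,\boldsymbol y)]\le a$ for all $x\in\mathcal X$; (ii) there exist $L_1,L_2>0$ such that $x\mapsto\mathbb E_{\boldsymbol y}[f(x,\boldsymbol y)]$ is $L_1$-smooth and $x\mapsto\mathbb E_{\boldsymbol y}[g(x,\boldsymbol y)]$ is $L_2$-smooth; (iii) $|\lambda_k-\bar\lambda|^2$ is monotonically decreasing in $k$; (iv) $\beta_k<\frac1{L_1+\lambda_k^2L_2}$ for all $k$, $\sum_{k=0}^\infty\beta_k=\infty$ and $\sum_{k=0}^\infty\beta_k^2<\infty$; (v) there exist $b_1,b_2>0$ such that for all $k$ and $x\in\mathcal X$ $$\mathbb E_{\boldsymbol y}\Big[\big\|\nabla_x[f(x,\boldsymbol y)+\lambda_kg(x,\boldsymbol y)]-\mathbb E_{\boldsymbol y}\big[\nabla_x[f(x,\boldsymbol y)+\lambda_kg(x,\boldsymbol y)]\big]\big\|_{\mathcal X}^2\Big]\le b_1+b_2\lambda_k^2 .$$ Then $$\liminf_{k\to\infty}\|\nabla_x\Psi_{\lambda_k}(x_k)\|_{\mathcal X}^2=0\quad\text{almost 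surely.}$$
   Context: $\mathcal X=\mathcal Z\times\mathbb R^d$ with $\mathcal Z$ a Hilbert space, with the product Hilbert norm. $U$ is the parameter domain with probability measure $\mu$; $\mathbb E_{\boldsymbol y}$ is expectation over $\boldsymbol y\sim\mu$. $f,g:\mathcal X\times U\to[0,\infty)$ are differentiable in $x$, and expectations and gradients in $x$ may be interchanged. For $\lambda\ge0$, $\Psi_\lambda(x):=\mathbb E_{\boldsymbol y}[f(x,\boldsymbol y)+\lambda g(x,\boldsymbol y)]$. A function $F:\mathcal X\to\mathbb R$ is $L$-smooth if it is differentiable and $\nabla_xF$ is $L$-Lipschitz continuous. The initial value $x_0$ is deterministic. *)

(* Defs.v *)
From HB Require Import structures.
From mathcomp Require Export all_boot all_order all_algebra.
From mathcomp Require Export all_classical all_reals all_analysis.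
Export Order.TTheory GRing.Theory Num.Theory.
Export numFieldNormedType.Exports.

Set Implicit Arguments.
Unset Strict Implicit.
Unset Printing Implicit Defensive.

Local Open Scope classical_set_scope.
Local Open Scope ring_scope.

(** * Hilbert spaces *)

(* A Hilbert space is a complete normed space with an inner product [ip] that
   induces its norm. *)
Definition induces_norm (R : realType) (Z : normedModType R)
    (ip : {dot Z for idfun}) : Prop :=
  forall z : Z, `|z| ^+ 2 = ip z z.

(* The inner product of the Hilbert space [Z * R^d]. The library norm on the
   type [Z * 'rV[R]_d] is a max norm. It is equivalent to
   [hnorm (prod_dot ip)], so limits, Fréchet differentiability, strong
   measurability and Bochner integrals are the same for both norms; gradients,
   Lipschitz constants and variances are taken with respect to [prod_dot ip]. *)
Definition prod_dot (R : realType) (Z : normedModType R)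
    (ip : {dot Z for idfun}) (d : nat) (x y : Z * 'rV[R]_d) : R :=
  ip x.1 y.1 + \sum_(i < d) x.2 0 i * y.2 0 i.

Section Hilbert.
Context {R : realType} {V : normedModType R}.
Variable dot : V -> V -> R.

Definition hnorm (v : V) : R := Num.sqrt (dot v v).

(* The Riesz representative of the Fréchet derivative of [F] at [x]. *)
Definition grad (F : V -> R) (x : V) : V :=
  xget 0 [set v | forall h, 'd F x h = dot v h].

Definition smooth (L : R) (F : V -> R) : Prop :=
  (forall x, differentiable F x) /\
  (forall x y, hnorm (grad F x - grad F y) <= L * hnorm (x - y)).

End Hilbert.

(** * Strong measurability and Bochner integral *)

Section Bochner.
Context {R : realType} {V : normedModType R} {d : measure_display}
  {T : measurableType d}.
Implicit Types (s G : T -> V).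

Definition simple_function s : Prop :=
  finite_set (range s) /\ forall v, measurable (s @^-1` [set v]).

Definition strongly_measurable G : Prop :=
  exists s : nat -> T -> V,
    (forall n, simple_function (s n)) /\
    (forall t, s n t @[n --> \oo] --> G t).

Variable mu : {measure set T -> \bar R}.

(* Only meant for finite [mu], because of [fine]. *)
Definition simple_integral s : V :=
  \sum_(v \in range s) fine (mu (s @^-1` [set v])) *: v.

Definition is_bochner_integral G (m : V) : Prop :=
  exists s : nat -> T -> V,
    [/\ forall n, simple_function (s n),
        forall t, s n t @[n --> \oo] --> G t,
        (\int[mu]_t (`|G t - s n t|)%:E @[n --> \oo] --> 0)%E
      & simple_integral (s n) @[n --> \oo] --> m].

Definition bochner_integral G : V := xget 0 [set m | is_bochner_integral G m].

End Bochner.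

(* [G (xi t) u] is strongly measurable in [(t, u)] for every strongly measurable
   [xi]. For separable [W] this is strong measurability of [G] on the product of
   the Borel sets of [W] with the measurable sets of [U]. For arbitrary [W] it
   holds as soon as [G] is continuous in its first argument and strongly
   measurable in the second. *)
Definition superposition_measurable (R : realType) (W V : normedModType R)
    (dU : measure_display) (U : measurableType dU) (G : W -> U -> V) : Prop :=
  forall (d : measure_display) (T : measurableType d) (xi : T -> W),
    strongly_measurable xi ->
    strongly_measurable (fun p : T * U => G (xi p.1) p.2).

(** * Independent samples *)

Section Samples.
Context {R : realType} {dO dU : measure_display} {Omega : measurableType dO}
  {U : measurableType dU}.
Variables (P : probability Omega R) (mu : probability U R).
Variable y : nat -> {RV P >-> U}.

Definition mutually_independent : Prop :=
  forall (J : seq nat) (A : nat -> set U), uniq J ->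
    (forall k, measurable (A k)) ->
    P (\bigcap_(k in [set` J]) y k @^-1` A k) =
    (\prod_(k <- J) P (y k @^-1` A k))%E.

Definition iid_samples : Prop :=
  mutually_independent /\
  forall k A, measurable A -> distribution P (y k) A = mu A.

End Samples.

(** * The penalized stochastic objective *)

Section Objective.
Context {R : realType} {V : normedModType R} {dU : measure_display}
  {U : measurableType dU}.
Variables (dot : V -> V -> R) (mu : probability U R).
Implicit Types (h f g : V -> U -> R).

Definition mean h (x : V) : R := \int[mu]_u h x u.

Definition penalized f g (l : R) (x : V) (u : U) : R := f x u + l * g x u.

Definition Psi f g (l : R) : V -> R := mean (penalized f g l).

Definition xgrad h (x : V) (u : U) : V := grad dot (h^~ u) x.

(* The regularity of a random function [h]; the last clause says that
   expectation and gradient may be interchanged, the expectation of the gradient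
   being a Bochner integral. *)
Definition regular h : Prop :=
  [/\ forall x u, 0 <= h x u,
      forall x u, differentiable (h^~ u) x,
      forall x, mu.-integrable setT (EFin \o h x),
      superposition_measurable (xgrad h)
    & forall x, is_bochner_integral mu (xgrad h x) (grad dot (mean h) x)].

Definition gradient_variance h (x : V) : \bar R :=
  (\int[mu]_u (hnorm dot (xgrad h x u - bochner_integral mu (xgrad h x)) ^+ 2)%:E)%E.

End Objective.

(* Main.v *)
From HB Require Import structures.
Require Import Defs.
From mathcomp Require Import measurable_realfun.
From mathcomp Require Import ring lra.

(** The objectives [Phi k = Psi (lambda k)] are nonnegative, and they are all
    [L]-smooth for one [L], since the monotone distance of [lambda k] to
    [lambda_bar] bounds the penalties. From a fixed point, the descent lemma and
    the variance bound give, once [L * beta k <= 1] ([expected_descent]),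

      E[Phi k (x_{k+1})] <= Phi k (x_k) - beta_k / 2 |grad Phi k (x_k)|^2
                            + C beta_k^2.

    Passing from [Phi k] to [Phi k.+1] costs at most
    [(lambda k.+1 - lambda k) * a], because the mean of [g] is at most [a]; these
    costs telescope and stay bounded. Taking expectations over all samples and
    summing, [sum beta_k E|grad Phi k (x_k)|^2] is finite, so
    [sum beta_k |grad Phi k (x_k)|^2] is finite almost surely ([ae_summable]), and
    since [sum beta_k = +oo] the squared gradients have lower limit zero
    ([limn_einf_eq0]). No conditional expectation or martingale convergence is
    needed: only full expectations occur.

    The expectation over the samples is split by Tonelli's theorem
    ([integral_past]): the iterate [x k] is strongly measurable for the
    sigma-algebra generated by the first [k] samples ([iterate_adapted]), and that
    sigma-algebra is independent of the sample [y k] ([past_independent]). The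
    superposition hypothesis on the gradients is what keeps the iterates
    measurable when [Z] is not separable.

    Gradients are Riesz representatives, so the existence of gradients rests on
    the Riesz theorem, proved here for [Z] and transferred to [Z * R^d]
    ([riesz_representation], [prod_dot_hilbert]). The Bochner integral is handled
    through inner products with fixed vectors ([bochner_dot]). *)

Set Implicit Arguments.
Unset Strict Implicit.
Unset Printing Implicit Defensive.

Local Open Scope classical_set_scope.
Local Open Scope ring_scope.

(** * Hilbert inner products *)

(** What the argument uses of a Hilbert inner product [dot] on a normed space
    [V]: a symmetric positive bilinear form whose norm [hnorm dot] is equivalent
    to the given norm of [V], and for which the continuous linear forms are
    represented by vectors. Definiteness follows from [dot_equiv]. *)
Record hilbert_dot (R : realType) (V : normedModType R) (dot : V -> V -> R) : Prop :=
  HilbertDot {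
  dotC : forall u v, dot u v = dot v u;
  dotDl : forall u v w, dot (u + v) w = dot u w + dot v w;
  dotZl : forall (c : R) u w, dot (c *: u) w = c * dot u w;
  dot_ge0 : forall u, 0 <= dot u u;
  dot_equiv : exists2 C : R, 0 < C &
    forall u, hnorm dot u <= C * `|u| /\ `|u| <= C * hnorm dot u;
  dot_riesz : forall phi : {linear V -> R}, continuous phi ->
    exists v, forall h, phi h = dot v h }.

Section HilbertDotTheory.
Context {R : realType} {V : normedModType R} (dot : V -> V -> R).
Hypothesis H : hilbert_dot dot.
Local Notation nrm := (hnorm dot).

Lemma dotDr u v w : dot u (v + w) = dot u v + dot u w.
Proof. by rewrite (dotC H) (dotDl H) !(dotC H u). Qed.

Lemma dotZr (c : R) u v : dot u (c *: v) = c * dot u v.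
Proof. by rewrite (dotC H) (dotZl H) !(dotC H u). Qed.

Lemma dotNl u v : dot (- u) v = - dot u v.
Proof. by rewrite -scaleN1r (dotZl H) mulN1r. Qed.

Lemma dotNr u v : dot u (- v) = - dot u v.
Proof. by rewrite (dotC H) dotNl (dotC H). Qed.

Lemma dot0l v : dot 0 v = 0.
Proof. by rewrite -(scale0r 0) (dotZl H) mul0r. Qed.

Lemma dotBl u v w : dot (u - v) w = dot u w - dot v w.
Proof. by rewrite (dotDl H) dotNl. Qed.

Lemma dotBr u v w : dot u (v - w) = dot u v - dot u w.
Proof. by rewrite dotDr dotNr. Qed.

Lemma dot_sumr (I : Type) (r : seq I) (F : I -> V) v :
  dot v (\sum_(i <- r) F i) = \sum_(i <- r) dot v (F i).
Proof.
elim/big_rec2: _ => [|i x y _ <-]; first by rewrite (dotC H) dot0l.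
by rewrite dotDr.
Qed.

Lemma sqr_hnorm u : nrm u ^+ 2 = dot u u.
Proof. by rewrite /hnorm sqr_sqrtr// (dot_ge0 H). Qed.

Lemma hnorm_ge0 u : 0 <= nrm u.
Proof. exact: sqrtr_ge0. Qed.

Lemma hnorm_scale (c : R) u : nrm (c *: u) = `|c| * nrm u.
Proof.
by rewrite /hnorm (dotZl H) dotZr mulrA -expr2 sqrtrM ?sqr_ge0// sqrtr_sqr.
Qed.

Lemma hnorm_opp u : nrm (- u) = nrm u.
Proof. by rewrite -scaleN1r hnorm_scale normrN1 mul1r. Qed.

Lemma dot_sqrB (a b : R) u v : dot (b *: u - a *: v) (b *: u - a *: v) =
  b ^+ 2 * dot u u - 2 * a * b * dot u v + a ^+ 2 * dot v v.
Proof.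
rewrite dotBl !dotBr !(dotZl H) !dotZr (dotC H v u); ring.
Qed.

Lemma dot_eq0 u : dot u u = 0 -> u = 0.
Proof.
move=> u0; have [C C0 /(_ u)[_]] := dot_equiv H.
by rewrite /hnorm u0 sqrtr0 mulr0 normr_le0 => /eqP.
Qed.

Lemma dot_CauchySchwarz u v : `|dot u v| <= nrm u * nrm v.
Proof.
rewrite -(ler_pXn2r (n:=2))// ?nnegrE ?mulr_ge0 ?hnorm_ge0//.
rewrite exprMn !sqr_hnorm -normrX ger0_norm ?sqr_ge0//.
have [v0|v0] := eqVneq (dot v v) 0.
  have -> := dot_eq0 v0; rewrite (dotC H) dot0l dot0l expr0n/= mulr0//.
have vp : 0 < dot v v by rewrite lt_def v0 (dot_ge0 H).
have := dot_ge0 H (dot v v *: u - dot u v *: v); rewrite dot_sqrB => h.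
rewrite -(ler_pM2l vp); lra.
Qed.

Lemma ler_hnormD u v : nrm (u + v) <= nrm u + nrm v.
Proof.
rewrite -(ler_pXn2r (n:=2))// ?nnegrE ?addr_ge0 ?hnorm_ge0//.
rewrite sqr_hnorm sqrrD !sqr_hnorm (dotDl H) !dotDr (dotC H v u).
have := le_trans (ler_norm _) (dot_CauchySchwarz u v); lra.
Qed.

Lemma dot_inj u v : (forall h, dot u h = dot v h) -> u = v.
Proof.
move=> uv; apply/eqP; rewrite -subr_eq0; apply/eqP/dot_eq0.
by rewrite dotBl uv subrr.
Qed.

Lemma hnorm_continuous : continuous nrm.
Proof.
have [C C0 HC] := dot_equiv H.
move=> x; apply/cvgrPdist_le => e e0.
have eC : 0 < e / C by rewrite divr_gt0.
near=> t.
have lip : `|nrm x - nrm t| <= nrm (x - t).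
  rewrite ler_norml; apply/andP; split.
    have := ler_hnormD x (t - x); rewrite addrC subrK -[nrm (t - x)]hnorm_opp opprB; lra.
  have := ler_hnormD t (x - t); rewrite addrC subrK; lra.
apply: le_trans lip _; apply: le_trans (HC _).1 _.
have : `|x - t| <= e / C by near: t; exact: (@cvgr_dist_le _ _ _ _ _ id x).
by rewrite ler_pdivlMr// mulrC.
Unshelve. all: by end_near. Qed.

Lemma dot_continuous v : continuous (dot v).
Proof.
have [C C0 HC] := dot_equiv H.
move=> x; apply/cvgrPdist_le => e e0.
have n0 : 0 < nrm v * C + 1 by rewrite ltr_pwDr// mulr_ge0// ?hnorm_ge0// ltW.
near=> t.
rewrite -dotBr; apply: le_trans (dot_CauchySchwarz _ _) _.
apply: le_trans (ler_wpM2l (hnorm_ge0 _) (HC _).1) _.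
have : `|x - t| <= e / (nrm v * C + 1).
  near: t; apply: cvgr_dist_le => //; exact: divr_gt0.
rewrite ler_pdivlMr// mulrDr mulr1 => h.
rewrite mulrA mulrC; apply: le_trans h; rewrite lerDl//.
Unshelve. all: by end_near. Qed.

End HilbertDotTheory.

(** * Riesz representation and the product Hilbert space *)

Section Riesz.
Context {R : realType} {Z : completeNormedModType R} (ip : Z -> Z -> R).
Hypothesis ipC : forall u v, ip u v = ip v u.
Hypothesis ipDl : forall u v w, ip (u + v) w = ip u w + ip v w.
Hypothesis ipZl : forall (c : R) u w, ip (c *: u) w = c * ip u w.
Hypothesis ip_norm : forall z, `|z| ^+ 2 = ip z z.

Lemma ipDr u v w : ip u (v + w) = ip u v + ip u w.
Proof. by rewrite !(ipC u) ipDl. Qed.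

Lemma ipZr (c : R) u w : ip u (c *: w) = c * ip u w.
Proof. by rewrite !(ipC u) ipZl. Qed.

(** Riesz representation: the representative of [phi] is the minimiser of
    [J z = ip z z / 2 - phi z]. By the parallelogram identity, minimising
    sequences are Cauchy. *)
Lemma riesz_representation (phi : Z -> R) (K : R) :
  {morph phi : x z / x + z} -> (forall (c : R) x, phi (c *: x) = c * phi x) ->
  (forall x, `|phi x| <= K * `|x|) ->
  exists v, forall h, phi h = ip v h.
Proof.
move=> phiD phiZ phiK.
pose N (z : Z) : R := `|z|.
have NE z : N z ^+ 2 = ip z z by exact: ip_norm.
pose J (z : Z) : R := ip z z / 2 - phi z.
have Jlb z : - K ^+ 2 / 2 <= J z.
  have h : phi z <= K * N z := le_trans (ler_norm _) (phiK z).
  rewrite /J -NE; move: (N z) (phi z) h => n p h.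
  have : 0 <= (n - K) ^+ 2 by exact: sqr_ge0.
  lra.
pose m := inf (range J).
have hJ : has_inf (range J).
  split; first by exists (J 0); exists 0.
  by exists (- K ^+ 2 / 2) => _ [z _ <-].
have mJ z : m <= J z.
  by apply: ge_inf; [case: hJ|exists z].
(* Parallelogram identity at [u], [v] and their midpoint. *)
have Jpar u v : N (u - v) ^+ 2 <= 4 * (J u - m) + 4 * (J v - m).
  have := mJ (2^-1 *: (u + v)); rewrite /J NE phiZ phiD.
  rewrite -(scaleN1r v) !(ipZl, ipZr, ipDl, ipDr) (ipC v u); lra.
have zex n : exists z, J z < m + harmonic n.
  have [_ [z _ <-] zm] := inf_adherent (harmonic_gt0 n) hJ.
  by exists z.
pose z n := sval (cid (zex n)).
have zP n : J (z n) < m + harmonic n by rewrite /z; case: cid.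
have harm0 := @cvg_harmonic R.
have zc : cauchy (z @ \oo).
  apply/cauchy_ballP => e e0.
  have e8 : 0 < e ^+ 2 / 8 by rewrite divr_gt0// exprn_gt0.
  have near8 : \forall n \near \oo, harmonic n < e ^+ 2 / 8.
    have /cvgrPdist_lt/(_ _ e8) := harm0; apply: filterS => n.
    by rewrite sub0r normrN ger0_norm// harmonic_ge0.
  pose A := [set w | J w < m + e ^+ 2 / 8].
  have zA : (z @ \oo) A.
    by apply: filterS near8 => n hn; apply: lt_trans (zP n) _; rewrite ltrD2l.
  exists (A, A) => // -[u v] [/= Au Av]; rewrite -ball_normE /ball_/=.
  rewrite -(ltr_pXn2r (n:=2)) ?nnegrE ?normr_ge0 ?ltW// -/(N (u - v)).
  apply: le_lt_trans (Jpar u v) _; move: Au Av; rewrite /A/=; lra.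
have /cauchy_cvgP/cvg_ex[/= l zl] := zc.
have phic : phi (z n) @[n --> \oo] --> phi l.
  apply/cvgrPdist_le => e e0.
  have K1 : 0 < `|K| + 1 by rewrite ltr_pwDr.
  have eK : 0 < e / (`|K| + 1) by rewrite divr_gt0.
  near=> n.
  have -> : phi l - phi (z n) = phi (l - z n).
    by rewrite phiD -(scaleN1r (z n)) phiZ mulN1r.
  have : `|l - z n| <= e / (`|K| + 1) by near: n; have /cvgrPdist_le/(_ _ eK) := zl.
  rewrite ler_pdivlMr// => h; apply: le_trans h; apply: le_trans (phiK _) _.
  by rewrite mulrC ler_wpM2l// (le_trans (ler_norm _))// lerDl.
have Jl : J l <= m.
  have c : J (z n) @[n --> \oo] --> J l.
    apply: cvgB => //; apply: cvgM; last exact: cvg_cst.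
    under eq_fun do rewrite -NE.
    by rewrite -NE expr2; apply: cvgM; exact: cvg_norm.
  have c' : m + harmonic n @[n --> \oo] --> m.
    by rewrite -[X in _ --> X]addr0; apply: cvgD => //; exact: cvg_cst.
  by apply: (ler_cvg_to c c'); apply: nearW => n; apply: ltW; exact: zP.
exists l => h; apply/eqP; rewrite -subr_eq0; apply/eqP.
set c := phi h - ip l h.
have [h0|h0] := eqVneq (ip h h) 0.
  have : `|h| ^+ 2 = 0 by rewrite ip_norm.
  move/eqP; rewrite sqrf_eq0 normr_eq0 => /eqP h00.
  rewrite /c h00 -(scale0r 0) phiZ ipZr; lra.
have hp : 0 < ip h h by rewrite lt_def h0 -ip_norm sqr_ge0.
(* [t] minimises the quadratic polynomial [t |-> J (l + t h)]. *)
pose t := c / ip h h.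
have := le_trans Jl (mJ (l + t *: h)); rewrite /J phiD phiZ.
rewrite !(ipZl, ipZr, ipDl, ipDr) (ipC h l).
have -> : t * ip h h = c by rewrite /t divfK.
have -> : t * phi h = t * c + t * ip l h by rewrite /c; ring.
move=> hh; have : t * c <= 0 by lra.
rewrite /t mulrAC pmulr_lle0 ?invr_gt0// -expr2 => c2.
by apply/eqP; rewrite -sqrf_eq0 eq_le c2 sqr_ge0.
Unshelve. all: by end_near. Qed.
End Riesz.

Section ProductHilbert.
Context {R : realType} {Z : completeNormedModType R} (ip : {dot Z for idfun}).
Hypothesis ip_norm : induces_norm ip.

Lemma ipC u v : ip u v = ip v u.
Proof. by rewrite hermC expr0 mul1r. Qed.

Lemma ipDl u v w : ip (u + v) w = ip u w + ip v w.
Proof. by rewrite linearDl. Qed.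

Lemma ipZl (c : R) u w : ip (c *: u) w = c * ip u w.
Proof. by rewrite linearZl_LR. Qed.

Variable d : nat.
Local Notation V := (Z * 'rV[R]_d)%type.
Local Notation dot := (prod_dot ip (d := d)).

(** The inner product of [Z * R^d] is a Hilbert inner product for the max norm
    of the product type. The representative of a linear form is obtained from
    the Riesz theorem on [Z] and from the values on the basis of [R^d]. *)
Lemma prod_dot_hilbert : hilbert_dot dot.
Proof.
have ge0 (u : V) : 0 <= dot u u.
  by rewrite addr_ge0// -?ip_norm ?sqr_ge0// sumr_ge0// => i _; rewrite -expr2 sqr_ge0.
split=> //.
- move=> u v; rewrite /prod_dot ipC; congr (_ + _).
  by apply: eq_bigr => i _; rewrite mulrC.
- move=> u v w; rewrite /prod_dot/= ipDl addrACA -big_split/=; congr (_ + _).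
  by apply: eq_bigr => i _; rewrite mxE mulrDl.
- move=> c u w; rewrite /prod_dot/= ipZl mulrDr mulr_sumr; congr (_ + _).
  by apply: eq_bigr => i _; rewrite mxE mulrA.
- have coord (r : 'rV[R]_d) i : `|r 0 i| <= `|r|.
    rewrite [leRHS]/Num.norm /= mx_normrE; apply/bigmax_geP; right => /=.
    by exists (0, i).
  have nrm1 (u : V) : `|u.1| <= `|u| by rewrite prod_normE le_max lexx.
  have nrm2 (u : V) : `|u.2| <= `|u| by rewrite prod_normE le_max lexx orbT.
  pose C : R := 1 + d%:R.
  have C1 : 1 <= C by rewrite lerDl.
  have C0 : 0 < C by exact: lt_le_trans C1.
  exists C => // u; split.
    rewrite -(ler_pXn2r (n:=2))// ?nnegrE ?sqrtr_ge0// ?mulr_ge0// ?(ltW C0)//.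
    rewrite sqr_sqrtr// exprMn (@le_trans _ _ (C * `|u| ^+ 2))//; last first.
      by rewrite ler_wpM2r// ?sqr_ge0// expr2 ler_peMr// ltW.
    rewrite /prod_dot -ip_norm /C mulrDl mul1r lerD//.
      by rewrite ler_pXn2r// ?nnegrE.
    rewrite mulr_natl -[X in _ *+ X]card_ord -sumr_const ler_sum// => i _.
    rewrite -expr2 -real_normK ?num_real// ler_pXn2r// ?nnegrE//.
    exact: le_trans (coord _ _) (nrm2 _).
  have hle (t : R) : 0 <= t -> t ^+ 2 <= dot u u -> t <= C * hnorm dot u.
    move=> t0 tu; apply: le_trans (_ : hnorm dot u <= _); last first.
      by rewrite ler_peMl// sqrtr_ge0.
    by rewrite -(ler_pXn2r (n:=2))// ?nnegrE ?sqrtr_ge0// sqr_sqrtr.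
  have sge0 : 0 <= \sum_(i < d) u.2 0 i * u.2 0 i.
    by apply: sumr_ge0 => i _; rewrite -expr2 sqr_ge0.
  rewrite prod_normE ge_max; apply/andP; split.
    by apply: hle => //; rewrite ip_norm /prod_dot lerDl.
  rewrite [leLHS]/Num.norm /= mx_normrE; apply/bigmax_leP; split.
    by rewrite mulr_ge0 ?sqrtr_ge0// ltW.
  move=> [i0 i] _ /=; rewrite (ord1 i0); apply: hle => //.
  rewrite real_normK ?num_real// /prod_dot (bigD1 i)//= -expr2 addrCA lerDl.
  rewrite addr_ge0// -?ip_norm ?sqr_ge0//.
  by apply: sumr_ge0 => j _; rewrite -expr2 sqr_ge0.
- move=> phi phic.
  have [K HK] : exists K, forall x, `|phi x| <= K * `|x|.
    have /linear_boundedP := @continuous_linear_bounded _ _ _ 0 phi (phic 0).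
    by move=> /pinfty_ex_gt0[K _ HK]; exists K.
  have [|||v Hv] := @riesz_representation R Z ip ipC ipDl ipZl ip_norm
    (fun z => phi (z, 0)) K.
  + by move=> x z; rewrite -linearD/=; congr (phi _); congr pair; rewrite addr0.
  + by move=> c x; rewrite -[c * _]linearZ/=; congr (phi _); congr pair; rewrite scaler0.
  + move=> x; apply: le_trans (HK _) _.
    by rewrite prod_normE /= normr0 max_l.
  exists (v, \row_i phi (0, delta_mx 0 i)) => h.
  rewrite /prod_dot/= -Hv.
  have e : h = (h.1, 0) + \sum_(i < d) h.2 0 i *: ((0, delta_mx 0 i) : V).
    rewrite [LHS]surjective_pairing.
    have -> : \sum_(i < d) h.2 0 i *: ((0, delta_mx 0 i) : V) = (0, h.2).
      rewrite [in RHS](row_sum_delta h.2).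
      elim/big_rec2: _ => [//|i x y _ ->].
      by congr pair; rewrite /= scaler0 add0r.
    by congr pair; rewrite ?addr0 ?add0r.
  rewrite [in LHS]e linearD linear_sum/=; congr (_ + _).
  by apply: eq_bigr => i _; rewrite linearZ mxE/= mulrC.
Qed.
End ProductHilbert.

(** * Gradients and the descent lemma *)

Section GradientTheory.
Context {R : realType} {V : normedModType R} (dot : V -> V -> R).
Hypothesis H : hilbert_dot dot.
Local Notation nrm := (hnorm dot).
Local Notation gradient := (grad dot).

(** By the Riesz property every differentiable function has a gradient, so the
    default value in the definition of [grad] is never used. *)
Lemma gradP (F : V -> R) x : differentiable F x ->
  forall h, 'd F x h = dot (gradient F x) h.
Proof.
move=> dF; rewrite /grad.
have [|v Hv] := dot_riesz H (phi := 'd F x); first exact: diff_continuous.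
by apply: (@xgetPex _ 0 [set v | forall h, 'd F x h = dot v h]); exists v.
Qed.

Lemma grad_unique (F : V -> R) x v : (forall h, 'd F x h = dot v h) ->
  gradient F x = v.
Proof.
move=> Hv; apply: (dot_inj H) => h; rewrite -Hv.
have /(_ (ex_intro _ v Hv) h) -> // :=
  @xgetPex _ 0 [set v | forall h, 'd F x h = dot v h].
Qed.

Lemma gradDZ (F G : V -> R) (l : R) x :
  differentiable F x -> differentiable G x ->
  gradient (fun z => F z + l * G z) x = gradient F x + l *: gradient G x.
Proof.
move=> dF dG; apply: grad_unique => h.
have -> : (fun z => F z + l * G z) = F + l *: G by apply/funext.
rewrite (diffD dF (differentiableZ l dG)).
transitivity ('d F x h + 'd (l *: G) x h); first by [].
transitivity ('d F x h + l * 'd G x h).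
  exact: (congr1 (fun k : V -> R => 'd F x h + k h) (diffZ l dG)).
by rewrite (gradP dF) (gradP dG) (dotDl H) (dotZl H).
Qed.

Lemma differentiableDZ (F G : V -> R) (l : R) x :
  differentiable F x -> differentiable G x ->
  differentiable (fun z => F z + l * G z) x.
Proof.
move=> dF dG.
have -> : (fun z => F z + l * G z) = F + l *: G by apply/funext.
by apply: differentiableD => //; exact: differentiableZ.
Qed.

Lemma smoothDZ (F G : V -> R) (L1 L2 l : R) : 0 <= l ->
  smooth dot L1 F -> smooth dot L2 G ->
  smooth dot (L1 + l * L2) (fun z => F z + l * G z).
Proof.
move=> l0 [dF LF] [dG LG]; split=> [x|x y]; first exact: differentiableDZ.
rewrite !gradDZ//.
have -> : gradient F x + l *: gradient G x - (gradient F y + l *: gradient G y)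
  = (gradient F x - gradient F y) + l *: (gradient G x - gradient G y).
  by rewrite opprD addrACA scalerBr.
apply: le_trans (ler_hnormD H _ _) _; rewrite (hnorm_scale H) ger0_norm// mulrDl.
by apply: lerD => //; rewrite -mulrA ler_wpM2l.
Qed.

Lemma is_derive_line (F : V -> R) x h t : differentiable F (x + t *: h) ->
  is_derive t (1 : R) (fun s : R => F (x + s *: h))
    (dot (gradient F (x + t *: h)) h).
Proof.
move=> dF.
have dl : is_diff t (fun s : R => x + s *: h) ( *:%R ^~ h).
  have -> : (fun s : R => x + s *: h) = cst x + *:%R ^~ h by apply/funext.
  by rewrite -[X in is_diff _ _ X]add0r; apply: is_diffD.
have dl' : differentiable (fun s : R => x + s *: h) t by case: dl.
have dc : differentiable (F \o (fun s : R => x + s *: h)) t.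
  exact: differentiable_comp.
apply: DeriveDef; first exact: diff_derivable.
by rewrite deriveE// diff_comp//= diff_val/= scale1r gradP.
Qed.

(** The descent lemma. Along the segment from [x] to [x + h], the function minus
    its quadratic model has a nonpositive derivative. *)
Lemma descent (F : V -> R) (L : R) x h : smooth dot L F ->
  F (x + h) <= F x + dot (gradient F x) h + L / 2 * dot h h.
Proof.
move=> [dF LF].
pose c := dot (gradient F x) h.
pose q := L * dot h h.
pose psi (t : R) := F (x + t *: h) - (t * c + q / 2 * t ^+ 2).
pose dpsi (t : R) := dot (gradient F (x + t *: h)) h - (c + q * t).
have dp t : is_derive t (1 : R) psi (dpsi t).
  rewrite /psi /dpsi; apply: is_deriveB; first exact: is_derive_line.
  apply: is_derive_eq;
  transitivity (t * 0 + c * 1 + q / 2 * (t * 1 + t * 1)); first by [].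
  by rewrite mulr0 add0r !mulr1 -mulr2n -[t *+ 2]mulr_natl mulrA divfK.
have [|t t01 e] := @MVT_segment R psi dpsi 0 1 ler01.
  apply: derivable_within_continuous => t _; exact: ex_derive.
move: e; rewrite /psi /dpsi scale1r scale0r addr0 => e.
suff : dpsi t <= 0.
  move: e; rewrite /dpsi /psi /q /c; lra.
have t0 : 0 <= t by move: t01; rewrite inE/= => /andP[].
rewrite /dpsi /c opprD addrA -(dotBl H) subr_le0.
apply: le_trans (ler_norm _) _; apply: le_trans (dot_CauchySchwarz H _ _) _.
apply: le_trans (ler_wpM2r (hnorm_ge0 _ _) (LF _ _)) _.
rewrite addrC addKr (hnorm_scale H) ger0_norm// /q -(sqr_hnorm H).
by rewrite le_eqVlt; apply/orP; left; apply/eqP; ring.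
Qed.

(** A nonnegative smooth function controls its gradient: apply the descent lemma
    to the gradient step of length [1 / L]. *)
Lemma grad_bound (F : V -> R) (L : R) x : 0 < L -> (forall z, 0 <= F z) ->
  smooth dot L F -> dot (gradient F x) (gradient F x) <= 2 * L * F x.
Proof.
move=> L0 F0 sF.
have := le_trans (F0 _) (descent x (- L^-1 *: gradient F x) sF).
rewrite (dotZl H) !(dotZr H) => h; rewrite -(ler_pM2l L0).
have := ler_wpM2l (ltW (mulr_gt0 L0 L0)) h; rewrite mulr0.
set D := dot _ _.
have -> : L * L * (F x + - L^-1 * D + L / 2 * (- L^-1 * (- L^-1 * D))) =
  L * (L * F x - D / 2) by field; rewrite gt_eqF.
rewrite pmulr_rge0// => ?; rewrite ler_pM2l//; lra.
Qed.

Lemma grad_continuous (F : V -> R) (L : R) : 0 <= L -> smooth dot L F ->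
  continuous (gradient F).
Proof.
move=> L0 [_ LF]; have [C C0 HC] := dot_equiv H.
move=> x; apply/cvgrPdist_le => e e0.
have n0 : 0 < C * (L * C) + 1 by rewrite ltr_pwDr// !mulr_ge0// ltW.
near=> t.
apply: le_trans (HC _).2 _.
apply: le_trans (ler_wpM2l (ltW C0) (LF _ _)) _.
apply: le_trans (ler_wpM2l (ltW C0) (ler_wpM2l L0 (HC _).1)) _.
have : `|x - t| <= e / (C * (L * C) + 1).
  by near: t; apply: (@cvgr_dist_le _ _ _ _ _ id x) => //; exact: divr_gt0.
rewrite ler_pdivlMr// mulrDr mulr1 => h; apply: le_trans h.
have -> : C * (L * (C * `|x - t|)) = `|x - t| * (C * (L * C)) by ring.
by rewrite lerDl.
Unshelve. all: by end_near. Qed.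

Lemma smooth_continuous (F : V -> R) (L : R) : smooth dot L F -> continuous F.
Proof. by move=> [dF _] x; apply: differentiable_continuous. Qed.

End GradientTheory.

Lemma smooth_le (R : realType) (V : normedModType R) (dot : V -> V -> R)
  (L L' : R) (F : V -> R) : L <= L' -> smooth dot L F -> smooth dot L' F.
Proof.
move=> LL' [dF LF]; split=> // x z; apply: le_trans (LF _ _) _.
by rewrite ler_wpM2r// sqrtr_ge0.
Qed.

(** * Strong measurability and the Bochner integral *)

Section StrongMeasurability.
Context {R : realType} {d : measure_display} {T : measurableType d}.

Lemma simple_preimage (V : normedModType R) (s : T -> V) (A : set V) :
  simple_function s -> measurable (s @^-1` A).
Proof.
move=> [fs ms].
rewrite (_ : s @^-1` A = \bigcup_(v in range s `&` A) s @^-1` [set v]).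
  by apply: fin_bigcup_measurable => // ; exact: finite_setIl.
apply/seteqP; split=> t /=.
  by move=> At; exists (s t) => //; split => //; exists t.
by move=> [v [_ Av] ->].
Qed.

Lemma simple_comp2 (V1 V2 W : normedModType R) (h : V1 -> V2 -> W) s1 s2 :
  simple_function s1 -> simple_function s2 ->
  simple_function (fun t : T => h (s1 t) (s2 t)).
Proof.
move=> [f1 m1] [f2 m2]; split.
  apply: sub_finite_set
    (finite_image (fun p => h p.1 p.2) (finite_setX f1 f2)) => w [t _ <-].
  by exists (s1 t, s2 t) => //; split; exists t.
move=> w.
rewrite (_ : _ @^-1` _ = \bigcup_(v in range s1)
    (s1 @^-1` [set v] `&` s2 @^-1` [set z | h v z = w])).
  apply: fin_bigcup_measurable => // v _; apply: measurableI => //.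
  exact: simple_preimage.
apply/seteqP; split=> t /=.
  by move=> <-; exists (s1 t) => //; exists t.
by move=> [v _ [-> ->]].
Qed.

Lemma strongly_measurable_cst (V : normedModType R) (v : V) :
  strongly_measurable (fun _ : T => v).
Proof.
exists (fun _ _ => v); split=> [n|t]; last exact: cvg_cst.
split; first by apply: sub_finite_set (finite_set1 v) => w [t _ <-].
by move=> w; have [->|?] := pselect (w = v); rewrite ?preimage_cst; case: ifP.
Qed.

Lemma strongly_measurable_comp2 (V1 V2 W : normedModType R)
  (h : V1 -> V2 -> W) (G1 : T -> V1) (G2 : T -> V2) :
  (forall x y, h z.1 z.2 @[z --> (x, y)] --> h x y) ->
  strongly_measurable G1 -> strongly_measurable G2 ->
  strongly_measurable (fun t => h (G1 t) (G2 t)).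
Proof.
move=> hc [s1 [ss1 c1]] [s2 [ss2 c2]].
exists (fun n t => h (s1 n t) (s2 n t)); split=> [n|t].
  exact: simple_comp2.
have c12 : (s1 n t, s2 n t) @[n --> \oo] --> (G1 t, G2 t) by exact: cvg_pair.
exact: (cvg_comp _ _ c12 (hc _ _)).
Qed.

Lemma strongly_measurableDZ (V : normedModType R) (c : R) (G1 G2 : T -> V) :
  strongly_measurable G1 -> strongly_measurable G2 ->
  strongly_measurable (fun t => G1 t + c *: G2 t).
Proof.
apply: (@strongly_measurable_comp2 _ _ _ (fun a b => a + c *: b)) => x y.
apply: cvgD; first exact: (@cvg_fst _ _ (nbhs x) (nbhs y)).
by apply: cvgZ; [exact: cvg_cst|exact: (@cvg_snd _ _ (nbhs x) (nbhs y))].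
Qed.

Lemma measurable_continuous_comp (V : normedModType R) (phi : V -> R)
  (G : T -> V) : continuous phi -> strongly_measurable G ->
  measurable_fun setT (phi \o G).
Proof.
move=> cphi [s [ss cs]].
apply: (@measurable_fun_cvg _ _ _ setT (fun n => phi \o s n)) => [n|t _].
  by move=> _ B _; rewrite setTI; exact: (simple_preimage (phi @^-1` B)).
exact: (cvg_comp _ _ (cs t) (cphi _)).
Qed.

End StrongMeasurability.

Lemma strongly_measurable_comp (R : realType) (V : normedModType R)
  (d d' : measure_display) (T : measurableType d) (T' : measurableType d')
  (h : T' -> T) (G : T -> V) : measurable_fun setT h ->
  strongly_measurable G -> strongly_measurable (G \o h).
Proof.
move=> mh [s [ss cs]]; exists (fun n => s n \o h); split=> [n|t]; last exact: cs.
have [fs ms] := ss n; split.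
  by apply: sub_finite_set fs => _ [t _ <-]; exists (h t).
by move=> v; rewrite -[_ @^-1` _]setTI; exact: (mh measurableT _ (ms v)).
Qed.

Section BochnerTheory.
Context {R : realType} {V : normedModType R} (dot : V -> V -> R).
Hypothesis H : hilbert_dot dot.
Context {d : measure_display} {T : measurableType d} (mu : probability T R).
Local Notation nrm := (hnorm dot).
Implicit Types (s G : T -> V).

(** Inner products commute with the integral of a simple function, by expansion
    over its finite range. *)
Lemma simple_dot_integrable s v : simple_function s ->
  mu.-integrable setT (fun t => (dot v (s t))%:E) /\
  (\int[mu]_t (dot v (s t))%:E = (dot v (simple_integral mu s))%:E)%E.
Proof.
move=> [fs ms].
pose r : seq V := finmap.enum_fset (fset_set (range s)).
have e t : (dot v (s t))%:E =
   (\sum_(u <- r) (dot v u)%:E * (\1_(s @^-1` [set u]) t)%:E)%E.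
  have str : s t \in r by rewrite in_fset_set// inE; exists t.
  rewrite (bigD1_seq _ str (finmap.fset_uniq _))/= indicE mem_set//= mule1.
  rewrite big1 ?adde0// => u us; rewrite indicE memNset ?mule0//=.
  by move=> su; move: us; rewrite su eqxx.
have int u : mu.-integrable setT
    (fun t => (dot v u)%:E * (\1_(s @^-1` [set u]) t)%:E)%E.
  by apply: integrableZl => //; exact: integrable_indic.
split.
  by rewrite (funext e); apply: integrable_sum.
under eq_integral do rewrite e.
rewrite integral_sum//= /simple_integral fsbig_finite//= (dot_sumr H) -sumEFin.
apply: eq_bigr => u _; rewrite integralZl//; last exact: integrable_indic.
rewrite integral_indic// setIT (dotZr H) mulrC EFinM fineK//.
exact: fin_num_measure.
Qed.

Lemma is_bochner_measurable G m : is_bochner_integral mu G m ->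
  strongly_measurable G.
Proof. by move=> [s [? ? _ _]]; exists s. Qed.

Lemma measurable_norm_sm G : strongly_measurable G ->
  measurable_fun setT (fun t => `|G t|).
Proof. exact: (measurable_continuous_comp (@norm_continuous _ V)). Qed.

Lemma measurable_dot_sm G v : strongly_measurable G ->
  measurable_fun setT (fun t => dot v (G t)).
Proof. exact: (measurable_continuous_comp (dot_continuous H (v := v))). Qed.

Lemma simple_sm s : simple_function s -> strongly_measurable s.
Proof. by move=> ss; exists (fun _ => s); split=> // t; exact: cvg_cst. Qed.

Lemma strongly_measurableB G1 G2 : strongly_measurable G1 ->
  strongly_measurable G2 -> strongly_measurable (fun t => G1 t - G2 t).
Proof.
move=> m1 m2; have := strongly_measurableDZ (-1) m1 m2.
by under eq_fun do rewrite scaleN1r.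
Qed.

(** Inner products commute with the Bochner integral; uniqueness and linearity of
    that integral are deduced from this. *)
Lemma bochner_dot G m v : is_bochner_integral mu G m ->
  mu.-integrable setT (fun t => (dot v (G t))%:E) /\
  (\int[mu]_t (dot v (G t))%:E = (dot v m)%:E)%E.
Proof.
move=> bG; have mG := is_bochner_measurable bG.
have [s [ss cs c0 cm]] := bG.
have [C C0 HC] := dot_equiv H.
pose K := nrm v * C.
have K0 : 0 <= K by rewrite mulr_ge0 ?hnorm_ge0// ltW.
have bnd (w : V) : `|dot v w| <= K * `|w|.
  apply: le_trans (dot_CauchySchwarz H _ _) _; rewrite /K -mulrA.
  by apply: ler_wpM2l; [exact: hnorm_ge0|exact: (HC _).1].
have mB n : strongly_measurable (fun t => G t - s n t).
  by apply: strongly_measurableB => //; exact: simple_sm.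
have mB' n : measurable_fun setT (fun t => (`|G t - s n t|)%:E).
  by apply/measurable_EFinP; exact: measurable_norm_sm.
have diff n : (\int[mu]_t `|(dot v (G t - s n t))%:E| <=
    K%:E * \int[mu]_t (`|G t - s n t|)%:E)%E.
  rewrite -ge0_integralZl//.
  apply: ge0_le_integral => //.
  - apply: measurableT_comp => //; apply/measurable_EFinP.
    exact: measurable_dot_sm.
  - by apply: measurable_funeM.
  - by move=> t _; rewrite -EFinM lee_fin; exact: bnd.
have /fine_cvgP[fin c0'] := c0.
have intd n : (\int[mu]_t (`|G t - s n t|)%:E)%E \is a fin_num ->
    mu.-integrable setT (fun t => (dot v (G t - s n t))%:E).
  move=> h; apply/integrableP; split.
    by apply/measurable_EFinP; exact: measurable_dot_sm.
  apply: le_lt_trans (diff n) _; apply: lte_mul_pinfty => //.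
  by rewrite -ge0_fin_numE// integral_ge0// => t _; rewrite lee_fin.
have intG : mu.-integrable setT (fun t => (dot v (G t))%:E).
  have [N _ /(_ N (leqnn _)) hN] := fin.
  have := integrableD measurableT (intd N hN) (simple_dot_integrable v (ss N)).1.
  apply: eq_integrable => // t _ /=.
  by rewrite -EFinD -(dotDr H) subrK.
split=> //.
have fG := integrable_fin_num measurableT intG.
rewrite -(fineK fG); congr EFin; set I := fine _.
apply: (@cvg_unique _ (@Rhausdorff R)
  ((fun n => dot v (simple_integral mu (s n))) @ \oo)) => /=; last first.
  exact: (cvg_comp _ _ cm (dot_continuous H (v := v) (x := m))).
apply/cvgrPdist_le => e e0.
have eK : 0 < e / (K + 1) by rewrite divr_gt0// ltr_pwDr.
have near_e := @cvgr_dist_le _ _ _ _ _ _ _ c0' _ eK.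
near=> n.
have fn : (\int[mu]_t (`|G t - s n t|)%:E)%E \is a fin_num by near: n.
have : `|0 - fine (\int[mu]_t (`|G t - s n t|)%:E)| <= e / (K + 1).
  by near: n; exact: near_e.
rewrite sub0r normrN ger0_norm; last first.
  by rewrite fine_ge0// integral_ge0// => t _; rewrite lee_fin.
rewrite ler_pdivlMr ?ltr_pwDr// mulrDr mulr1 mulrC => h.
have I0 : 0 <= fine (\int[mu]_t (`|G t - s n t|)%:E).
  by rewrite fine_ge0// integral_ge0// => t _; rewrite lee_fin.
apply: le_trans (_ : K * fine (\int[mu]_t (`|G t - s n t|)%:E) <= e); last first.
  by apply: le_trans h; rewrite lerDl.
rewrite -lee_fin EFinM fineK//; apply: le_trans (diff n).
have [i1 e1] := simple_dot_integrable v (ss n).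
have -> : (`|I - dot v (simple_integral mu (s n))|)%:E =
   (`| \int[mu]_t (dot v (G t - s n t))%:E |)%E.
  under eq_integral do rewrite (dotBr H) EFinB.
  by rewrite integralB// e1 -(fineK fG).
apply: le_abse_integral => //; exact: (measurable_int _ (intd n fn)).
Unshelve. all: by end_near. Qed.

Lemma bochner_unique G m m' : is_bochner_integral mu G m ->
  is_bochner_integral mu G m' -> m = m'.
Proof.
move=> b b'; apply: (dot_inj H) => h; rewrite !(dotC H _ h).
have [_ e] := bochner_dot h b; have [_ e'] := bochner_dot h b'.
by move: e; rewrite e' => -[].
Qed.

Lemma bochner_integralE G m : is_bochner_integral mu G m ->
  bochner_integral mu G = m.
Proof.
move=> b; apply: (@bochner_unique G) => //.
by apply: (@xgetPex _ 0 [set m | is_bochner_integral mu G m]); exists m.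
Qed.

Lemma simple_integralDZ (c : R) s1 s2 : simple_function s1 ->
  simple_function s2 -> simple_integral mu (fun t => s1 t + c *: s2 t) =
  simple_integral mu s1 + c *: simple_integral mu s2.
Proof.
move=> ss1 ss2; apply: (dot_inj H) => h; rewrite !(dotC H _ h).
have ss := simple_comp2 (fun a b => a + c *: b) ss1 ss2.
have [i1 e1] := simple_dot_integrable h ss1.
have [i2 e2] := simple_dot_integrable h ss2.
have [i e] := simple_dot_integrable h ss.
apply: EFin_inj; rewrite -e (dotDr H) (dotZr H) EFinD EFinM -e1 -e2.
under eq_integral do rewrite (dotDr H) (dotZr H) EFinD EFinM.
by rewrite integralD// ?integralZl//; exact: integrableZl.
Qed.

Lemma is_bochner_integralDZ (c : R) G1 G2 m1 m2 :
  is_bochner_integral mu G1 m1 -> is_bochner_integral mu G2 m2 ->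
  is_bochner_integral mu (fun t => G1 t + c *: G2 t) (m1 + c *: m2).
Proof.
move=> b1 b2.
have mG1 := is_bochner_measurable b1; have mG2 := is_bochner_measurable b2.
have [s1 [ss1 cs1 i1 c1]] := b1; have [s2 [ss2 cs2 i2 c2]] := b2.
have mN G s : strongly_measurable G -> simple_function s ->
    measurable_fun setT (fun t => (`|G t - s t|)%:E).
  move=> mG ss; apply/measurable_EFinP.
  by apply: (measurable_norm_sm (strongly_measurableB mG (simple_sm ss))).
exists (fun n t => s1 n t + c *: s2 n t); split.
- by move=> n; exact: (simple_comp2 (fun a b => a + c *: b)).
- by move=> t; apply: cvgD => //; exact: cvgZl_tmp.
- have up : ((\int[mu]_t (`|G1 t - s1 n t|)%:E +
      `|c|%:E * \int[mu]_t (`|G2 t - s2 n t|)%:E) @[n --> \oo] --> 0)%E.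
    rewrite -[X in _ --> X](adde0 0%E) -[X in _ --> (_ + X)%E](mule0 `|c|%:E).
    by apply: cvgeD => //; exact: cvgeZl.
  apply: squeeze_cvge up; last exact: cvg_cst.
  apply: nearW => n; rewrite integral_ge0//=.
  rewrite -ge0_integralZl//; last exact: mN.
  rewrite -ge0_integralD//; [|exact: mN|by apply: measurable_funeM; exact: mN].
  apply: ge0_le_integral => //.
  + by apply: (@mN _ (fun t => s1 n t + c *: s2 n t));
      [exact: strongly_measurableDZ|exact: (simple_comp2 (fun a b => a + c *: b))].
  + by apply: emeasurable_funD; [exact: mN|apply: measurable_funeM; exact: mN].
  + move=> t _; rewrite -EFinM -EFinD lee_fin opprD addrACA -scalerBr.
    by rewrite (le_trans (ler_normD _ _))// normrZ.
- rewrite (_ : (fun n => _) = (fun n =>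
      simple_integral mu (s1 n) + c *: simple_integral mu (s2 n))); last first.
    by apply/funext => n; rewrite -simple_integralDZ.
  by apply: cvgD => //; exact: cvgZl_tmp.
Qed.

End BochnerTheory.

(** * Independence of the past and the next sample *)

Section IndependentIntegral.
Context {R : realType} {dO dX dU : measure_display} {Omega : measurableType dO}
  {T : measurableType dX} {U : measurableType dU}.
Variables (P : probability Omega R) (mu : probability U R).
Local Open Scope ereal_scope.

(** If [X] and [Y] are independent and [Y] has law [mu], their joint law is a
    product measure, and Tonelli's theorem integrates [Y] out first. *)
Lemma integral_independent (X : Omega -> T) (Y : Omega -> U) :
  measurable_fun setT X -> measurable_fun setT Y ->
  (forall A B, measurable A -> measurable B ->
     P (X @^-1` A `&` Y @^-1` B) = P (X @^-1` A) * mu B) ->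
  forall h : T * U -> \bar R, measurable_fun setT h -> (forall p, 0 <= h p) ->
  \int[P]_w h (X w, Y w) = \int[P]_w \int[mu]_u h (X w, u).
Proof.
move=> mX mY XY h mh h0.
pose X' : {mfun Omega >-> T} := HB.pack X (isMeasurableFun.Build _ _ _ _ X mX).
pose Z w := (X w, Y w).
have mZ : measurable_fun setT Z by exact: measurable_fun_pair.
pose Z' : {mfun Omega >-> (T * U)%type} :=
  HB.pack Z (isMeasurableFun.Build _ _ _ _ Z mZ).
have law A : measurable A -> A `<=` setT ->
    distribution P Z' A = (distribution P X' \x mu) A.
  by move=> mA _; apply/esym; apply: product_measure_unique.
have := @ge0_integral_distribution _ _ _ _ _ P Z' h mh h0 => /= <-.
rewrite (eq_measure_integral (distribution P X' \x mu)) => [|A mA sA]; last first.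
  exact: law.
rewrite fubini_tonelli1// (@ge0_integral_distribution _ _ _ _ _ P X')//.
  exact: measurable_fun_fubini_tonelli_F.
by move=> t; apply: integral_ge0.
Qed.

End IndependentIntegral.

Section PastSigmaAlgebra.
Context {R : realType} {dO dU : measure_display} {Omega : measurableType dO}
  {U : measurableType dU}.
Variables (P : probability Omega R) (mu : probability U R).
Variable y : nat -> {RV P >-> U}.

(** The events prescribing measurable sets for the samples [y 0], ...,
    [y (k - 1)]; they form a pi-system. *)
Definition past_cylinders k : set (set Omega) :=
  [set E | exists2 A : nat -> set U, (forall j, measurable (A j)) &
     E = \bigcap_(j in `I_k) y j @^-1` A j].

(** [Omega] with the sigma-algebra generated by the first [k] samples. *)
Definition past k := g_sigma_algebraType (past_cylinders k).

Lemma measurable_sample k B : measurable B -> measurable (y k @^-1` B).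
Proof. by move=> mB; rewrite -[_ @^-1` _]setTI; exact: measurable_funP. Qed.

Lemma past_cylinders_measurable k : past_cylinders k `<=` measurable.
Proof.
move=> _ [A mA ->]; apply: bigcap_measurableType => j _.
exact: measurable_sample.
Qed.

Lemma past_cylindersI k : setI_closed (past_cylinders k).
Proof.
move=> _ _ [A mA ->] [B mB ->]; exists (fun j => A j `&` B j).
  by move=> j; exact: measurableI.
by rewrite -bigcapI.
Qed.

Lemma past_cylindersT k : past_cylinders k setT.
Proof.
exists (fun=> setT) => //.
by apply/seteqP; split.
Qed.

Lemma past_measurable k (A : set Omega) :
  measurable (A : set (past k)) -> measurable A.
Proof.
exact: (smallest_sub (@sigma_algebra_measurable _ Omega)
  (@past_cylinders_measurable k)).
Qed.

Lemma measurable_past_id k :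
  measurable_fun setT (id : Omega -> past k).
Proof. by move=> _ A mA; rewrite setTI; exact: (@past_measurable k A mA). Qed.

Lemma past_cylindersS k A : past_cylinders k A -> past_cylinders k.+1 A.
Proof.
move=> [B mB ->]; exists (fun j => if (j < k)%N then B j else setT).
  by move=> j; case: ifP.
apply/seteqP; split=> w /= Bw j /= jk.
  by case: ifPn => // jk'; exact: Bw.
by have := Bw j (ltnW jk); rewrite jk.
Qed.

Lemma measurable_past_succ k :
  measurable_fun setT (id : past k.+1 -> past k).
Proof.
move=> _ A mA; rewrite setTI; apply: sub_sigma_algebra2 mA.
exact: past_cylindersS.
Qed.

Lemma measurable_past_sample k :
  measurable_fun setT (y k : past k.+1 -> U).
Proof.
move=> _ B mB; rewrite setTI; apply: sub_sigma_algebra.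
exists (fun j => if j == k then B else setT).
  by move=> j; case: ifP.
apply/seteqP; split=> w /= Bw; last by have := Bw k (leqnn _); rewrite eqxx.
by move=> j _; case: eqP => // ->.
Qed.

Hypothesis y_iid : iid_samples mu y.

(** The past is independent of the next sample: both sides are finite measures
    in [A] that agree on the cylinders. *)
Lemma past_independent k (A : set Omega) (B : set U) :
  measurable (A : set (past k)) -> measurable B ->
  (P (A `&` y k @^-1` B) = P A * mu B)%E.
Proof.
move=> mA mB; have [indep law] := y_iid.
have mumr : (0 <= fine (mu B)) by exact: fine_ge0.
have mD := measurable_sample k mB.
have : mrestr P mD A = mscale (NngNum mumr) P A; last first.
  by rewrite /mrestr /mscale /= => ->; rewrite fineK ?fin_num_measure// muleC.
apply: (g_sigma_algebra_measure_unique (past_cylinders k)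
  (@past_cylinders_measurable k) (fun=> setT)) mA => //.
- by move=> _; exact: past_cylindersT.
- by rewrite bigcup_const//; exists 0%N.
- exact: past_cylindersI.
- move=> _ [C mC ->] /=; rewrite /mrestr /mscale /= fineK ?fin_num_measure//.
  (* [C] extended by [B] at index [k] describes the intersection. *)
  pose C' j := if (j < k)%N then C j else B.
  have mC' j : measurable (C' j) by rewrite /C'; case: ifP.
  have := indep (iota 0 k) C (iota_uniq _ _) mC.
  have iotaE n : [set` iota 0 n] = `I_n.
    by apply/seteqP; split=> j; rewrite /= mem_iota.
  rewrite iotaE => ->.
  have := indep (iota 0 k.+1) C' (iota_uniq _ _) mC'.
  rewrite iotaE -addn1 iotaD add0n big_cat/= big_seq1 /C' ltnn.
  rewrite [P (y k @^-1` B)](law k B mB) addn1 muleC => e.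
  transitivity (P (\bigcap_(j in `I_k.+1) y j @^-1` C' j)).
    congr (P _); apply/seteqP; split=> w /=.
      move=> [Cw Bw] j jk; rewrite /C' /=; case: ifPn => [jk'|]; first exact: Cw.
      rewrite -leqNgt => kj; rewrite (_ : j = k)//.
      by apply/eqP; rewrite eqn_leq kj andbT.
    move=> Cw; split=> [j jk|]; first by have := Cw j (ltnW jk); rewrite /C'/= jk.
    by have := Cw k (leqnn _); rewrite /C'/= ltnn.
  rewrite e; congr (_ * _)%E; apply: eq_big_seq => j; rewrite mem_iota/= add0n.
  by move=> ->.
- by move=> _ /=; rewrite /mrestr setTI (le_lt_trans (probability_le1 _ _))// ltry.
Qed.

Lemma integral_past k (h : past k * U -> \bar R) :
  measurable_fun setT h -> (forall p, (0 <= h p)%E) ->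
  (\int[P]_w h (w, y k w) = \int[P]_w \int[mu]_u h (w, u))%E.
Proof.
apply: (integral_independent (X := id : Omega -> past k)).
- exact: measurable_past_id.
- exact: measurable_funP.
- by move=> A B; exact: past_independent.
Qed.

End PastSigmaAlgebra.

(** * Series *)

(** If [sum beta = +oo] and a tail of [sum beta q] is finite, then [q] cannot
    stay above a positive constant. *)
Lemma limn_einf_eq0 (R : realType) (q beta : nat -> R) (N : nat) :
  (forall k, 0 <= q k) -> (forall k, 0 < beta k) ->
  (\sum_(0 <= k <oo) (beta k)%:E = +oo)%E ->
  (\sum_(0 <= k <oo) (beta (k + N)%N * q (k + N)%N)%:E < +oo)%E ->
  limn_einf (fun k => (q k)%:E) = 0%E.
Proof.
move=> q0 b0 bsum; rewrite (@nneseries_addn _ (fun k => (beta k * q k)%:E)).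
  2: by move=> k; rewrite lee_fin mulr_ge0// ltW.
move=> qsum; rewrite limn_einf_lim.
have bq0 k : (0 <= (beta k * q k)%:E)%E by rewrite lee_fin mulr_ge0// ltW.
have bk0 k : (0 <= (beta k)%:E)%E by rewrite lee_fin ltW.
have i0 n : (0 <= einfs (fun k => (q k)%:E) n)%E.
  by apply: le_ereal_inf_tmp => _ [k _ <-]; rewrite lee_fin.
apply/eqP; rewrite eq_le; apply/andP; split; last first.
  apply: lime_ge; first exact: is_cvg_einfs.
  exact: nearW.
apply: lime_le; first exact: is_cvg_einfs.
apply: nearW => n; rewrite leNgt; apply/negP => ninf.
pose M := maxn N n.
have [e e0 he] : exists2 e : R, 0 < e & forall k, (n <= k)%N -> e <= q k.
  have [e [e0 he]] : exists e : R, 0 < e /\ (e%:E <= einfs (fun k => (q k)%:E) n)%E.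
    case: (einfs _ n) ninf => [r||]//; last by exists 1; split; rewrite ?leey.
    by move=> r0; exists r.
  exists e => // k nk; rewrite -lee_fin; apply: le_trans he _.
  by apply: ereal_inf_lbound; exists k.
have bM : (\sum_(M <= k <oo) (beta k)%:E = +oo)%E.
  move: bsum; rewrite (@nneseries_split _ _ 0 M)//.
  rewrite add0n; move: (\sum_(M <= k <oo) (beta k)%:E)%E => S.
  by rewrite sumEFin; case: S.
have : (e%:E * \sum_(M <= k <oo) (beta k)%:E <=
        \sum_(M <= k <oo) (beta k * q k)%:E)%E.
  have eb0 k : (0 <= e%:E * (beta k)%:E)%E by rewrite mule_ge0// lee_fin ltW.
  rewrite -nneseriesZl// -(@nneseries_addn _ (fun k => (e%:E * (beta k)%:E)%E) M)//.
  rewrite -(@nneseries_addn _ (fun k => (beta k * q k)%:E) M)//.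
  apply: lee_nneseries => // k _.
  rewrite -EFinM lee_fin mulrC ler_wpM2l//; first exact: ltW.
  by apply: he; rewrite (leq_trans (leq_maxr N n))// leq_addl.
rewrite bM gt0_muley ?lte_fin// leye_eq => /eqP MM.
move: qsum; rewrite (@nneseries_split _ _ N (M - N))//.
by rewrite subnKC ?leq_maxl// MM sumEFin.
Qed.

(** Nonnegative functions with summable integrals are almost surely summable. *)
Lemma ae_summable (R : realType) (d : measure_display) (T : measurableType d)
  (P : probability T R) (h : nat -> T -> R) :
  (forall k, measurable_fun setT (h k)) -> (forall k w, 0 <= h k w) ->
  (\sum_(0 <= k <oo) \int[P]_w (h k w)%:E < +oo)%E ->
  {ae P, forall w, (\sum_(0 <= k <oo) (h k w)%:E < +oo)%E}.
Proof.
move=> mh h0; rewrite -integral_nneseries//; last 2 first.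
- by move=> k; apply/measurable_EFinP; exact: mh.
- by move=> k w _; rewrite lee_fin.
set S := fun w => _ => Soo.
have S0 w : (0 <= S w)%E by apply: nneseries_ge0 => k _ _; rewrite lee_fin.
have iS : P.-integrable setT S.
  apply/integrableP; split.
    apply: (@ge0_emeasurable_sum _ _ _ _ (fun k w => (h k w)%:E) xpredT).
      by move=> k w _ _; rewrite lee_fin.
    by move=> k _; apply/measurable_EFinP; exact: mh.
  by under eq_integral do rewrite gee0_abs//.
apply: filterS (integrable_ae measurableT iS) => w /(_ I).
by rewrite ge0_fin_numE.
Qed.

(** Distances to [c] that do not increase bound the sequence. *)
Lemma nonincreasing_dist_bounded (R : realType) (l : nat -> R) (c : R) :
  nonincreasing_seq (fun k => `|l k - c| ^+ 2) ->
  forall k, l k <= `|c| + `|l 0%N - c|.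
Proof.
move=> ldist k.
have : `|l k - c| <= `|l 0%N - c|.
  by rewrite -(ler_pXn2r (n:=2))// ?nnegrE//; exact: ldist.
move=> h; have h1 := ler_norm (l k - c); have h2 := ler_norm c; lra.
Qed.

Lemma summable_sqr_small (R : realType) (b : nat -> R) (e : R) : 0 < e ->
  (forall k, 0 <= b k) -> (\sum_(0 <= k <oo) (b k ^+ 2)%:E < +oo)%E ->
  exists N, forall k, (N <= k)%N -> b k <= e.
Proof.
move=> e0 b0 bs.
have bb k : (0 <= (b k ^+ 2)%:E)%E by rewrite lee_fin sqr_ge0.
have := @nneseries_tail_cvg _ _ xpredT bs (fun k _ => bb k).
move=> /fine_cvgP[fin]/cvgrPdist_lt/(_ _ (exprn_gt0 2 e0)) tail.
have [N _ HN] : \forall n \near \oo,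
    (\sum_(n <= k <oo) (b k ^+ 2)%:E)%E \is a fin_num /\
    `|0 - fine (\sum_(n <= k <oo) (b k ^+ 2)%:E)%E| < e ^+ 2.
  near=> n; split; first by near: n; exact: fin.
  by near: n; exact: tail.
exists N => k Nk; have [/= finN tailN] := HN k Nk.
rewrite -(ler_pXn2r (n:=2))// ?nnegrE ?(ltW e0)//.
have : ((b k ^+ 2)%:E <= \sum_(k <= n <oo) (b n ^+ 2)%:E)%E.
  rewrite (@nneseries_split _ _ k 1)// addn1 big_nat1 leeDl//.
  exact: nneseries_ge0.
rewrite -(fineK finN) lee_fin => h; apply: le_trans h _.
by apply: ltW; apply: le_lt_trans tailN; rewrite sub0r normrN ler_norm.
Unshelve. all: by end_near. Qed.

(** * One stochastic gradient step *)

Lemma integral_probability_cst (R : realType) (d : measure_display)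
  (T : measurableType d) (P : probability T R) (c : R) :
  (\int[P]_t c%:E = c%:E)%E.
Proof. by rewrite integral_cst// [X in (_ * X)%E](probability_setT P) mule1. Qed.

Section OneStep.
Context {R : realType} {V : normedModType R} (dot : V -> V -> R).
Hypothesis H : hilbert_dot dot.
Context {dU : measure_display} {U : measurableType dU} (mu : probability U R).

(** Expected decrease in one stochastic gradient step from a fixed point [x].
    With [g] the gradient of [F] at [x], the descent lemma bounds the new value
    by [c0 + c1 dot g G + c2 |G - g|^2]; the mean of [dot g G] is [dot g g]. *)
Lemma expected_descent (F : V -> R) (G : U -> V) (L B b : R) (x : V) :
  (forall z, 0 <= F z) -> 0 <= L -> smooth dot L F ->
  is_bochner_integral mu G (grad dot F x) ->
  (\int[mu]_u (hnorm dot (G u - grad dot F x) ^+ 2)%:E <= B%:E)%E ->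
  (\int[mu]_u (F (x - b *: G u))%:E <=
     (F x - b * (1 - L * b / 2) * dot (grad dot F x) (grad dot F x)
      + L * b ^+ 2 / 2 * B)%:E)%E.
Proof.
move=> F0 L0 sF bG; set g := grad dot F x => var.
have mG := is_bochner_measurable bG.
have [ig eg] := bochner_dot H g bG.
pose D u := hnorm dot (G u - g) ^+ 2.
have mD : measurable_fun setT (fun u => (D u)%:E).
  apply/measurable_EFinP; apply: measurable_funX.
  apply: (measurable_continuous_comp (hnorm_continuous H)).
  by apply: strongly_measurableB => //; exact: strongly_measurable_cst.
have iD : mu.-integrable setT (fun u => (D u)%:E).
  apply/integrableP; split => //.
  under eq_integral do rewrite gee0_abs ?lee_fin ?sqr_ge0//.
  exact: le_lt_trans var (ltry _).
pose c1 := L * b ^+ 2 - b.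
pose c0 := F x - b * (1 - L * b / 2) * dot g g - c1 * dot g g.
pose c2 := L * b ^+ 2 / 2.
have c20 : 0 <= c2 by rewrite divr_ge0// mulr_ge0// sqr_ge0.
have le u : F (x - b *: G u) <= c0 + c1 * dot g (G u) + c2 * D u.
  apply: le_trans (descent H x (- (b *: G u)) sF) _.
  rewrite /D (sqr_hnorm H) -/g -scaleNr (dotZl H) !(dotZr H).
  rewrite (dotBl H) !(dotBr H) (dotC H (G u) g).
  by rewrite /c0 /c1 /c2 le_eqVlt; apply/orP; left; apply/eqP; field.
have int1 : mu.-integrable setT (fun u => (c0 + c1 * dot g (G u))%:E).
  under eq_fun do rewrite EFinD EFinM.
  apply: integrableD => //; last exact: integrableZl.
  exact: finite_measure_integrable_cst.
have int2 : mu.-integrable setT (fun u => (c2 * D u)%:E).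
  by under eq_fun do rewrite EFinM; exact: integrableZl.
apply: (@le_trans _ _ (\int[mu]_u (c0 + c1 * dot g (G u) + c2 * D u)%:E)%E).
  apply: ge0_le_integral => //.
  - by move=> u _; rewrite lee_fin.
  - apply/measurable_EFinP.
    apply: (measurable_continuous_comp (smooth_continuous sF)).
    have := strongly_measurableDZ (- b) (strongly_measurable_cst x) mG.
    by under eq_fun do rewrite scaleNr.
  - by under eq_fun do rewrite EFinD; apply: emeasurable_funD;
      [exact: measurable_int int1|exact: measurable_int int2].
  - by move=> u _; rewrite lee_fin.
under eq_integral do rewrite EFinD.
rewrite integralD//; under eq_integral do rewrite EFinD EFinM.
rewrite integralD//; last first.
- exact: integrableZl.
- exact: finite_measure_integrable_cst.
rewrite integralZl// eg integral_probability_cst.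
under eq_integral do rewrite EFinM.
rewrite integralZl//.
apply: (@le_trans _ _ (c0%:E + c1%:E * (dot g g)%:E + c2%:E * B%:E)%E).
  by rewrite leeD2l// lee_wpmul2l// lee_fin.
by rewrite -!EFinM -!EFinD lee_fin /c0 subrK.
Qed.

End OneStep.

(** * Stochastic gradient descent *)

Section StochasticGradientDescent.
Context {R : realType} {V : normedModType R} (dot : V -> V -> R).
Hypothesis H : hilbert_dot dot.
Context {dU : measure_display} {U : measurableType dU} (mu : probability U R)
  {dO : measure_display} {Omega : measurableType dO} (P : probability Omega R).
Variable y : nat -> {RV P >-> U}.
Hypothesis y_iid : iid_samples mu y.

(* [G k] is an unbiased random gradient of the objective [Phi k], with variance
   at most [B]; all the objectives are [L]-smooth and nonnegative. *)
Variables (G : nat -> V -> U -> V) (Phi : nat -> V -> R) (beta : nat -> R).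
Hypothesis G_superposition : forall k, superposition_measurable (G k).
Hypothesis Phi_ge0 : forall k z, 0 <= Phi k z.
Hypothesis beta_gt0 : forall k, 0 < beta k.
Variables L B : R.
Hypothesis L0 : 0 < L.
Hypothesis B0 : 0 <= B.
Hypothesis Phi_smooth : forall k, smooth dot L (Phi k).
Hypothesis G_unbiased : forall k z,
  is_bochner_integral mu (G k z) (grad dot (Phi k) z).
Hypothesis G_variance : forall k z,
  (\int[mu]_u (hnorm dot (G k z u - grad dot (Phi k) z) ^+ 2)%:E <= B%:E)%E.
Variables (x0 : V) (x : nat -> Omega -> V).
Hypothesis x_init : forall w, x 0%N w = x0.
Hypothesis x_step : forall k w,
  x k.+1 w = x k w - beta k *: G k (x k w) (y k w).

Local Notation sqgrad k z := (hnorm dot (grad dot (Phi k) z) ^+ 2).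

(** The iterate [k.+1] as a function of the past and of the sample [k]. *)
Definition sgd_update k (p : past y k * U) : V :=
  x k p.1 - beta k *: G k (x k p.1) p.2.

Lemma sgd_update_measurable k : strongly_measurable (x k : past y k -> V) ->
  strongly_measurable (@sgd_update k).
Proof.
move=> mx; have m1 : strongly_measurable (fun p : past y k * U => x k p.1).
  exact: (strongly_measurable_comp (h := fst) measurable_fst mx).
have := strongly_measurableDZ (- beta k) m1 (G_superposition k mx).
by rewrite /sgd_update; under eq_fun do rewrite scaleNr.
Qed.

(** The [k]-th iterate depends only on the first [k] samples. *)
Lemma iterate_adapted k : strongly_measurable (x k : past y k -> V).
Proof.
elim: k => [|k IH].
  have -> : (x 0%N : past y 0 -> V) = (fun=> x0) by apply/funext => w; exact: x_init.
  exact: strongly_measurable_cst.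
have mZ : measurable_fun setT
    ((fun w => (w, y k w)) : past y k.+1 -> past y k * U).
  apply: measurable_fun_pair; first exact: measurable_past_succ.
  exact: measurable_past_sample.
have := strongly_measurable_comp mZ (sgd_update_measurable IH).
congr (strongly_measurable _); apply/funext => w; exact/esym/x_step.
Qed.

Lemma measurable_iterate_comp k (phi : V -> R) : continuous phi ->
  measurable_fun setT (fun w : Omega => phi (x k w)).
Proof.
move=> cphi; have mphi := measurable_continuous_comp cphi (iterate_adapted k).
exact: (measurableT_comp mphi (@measurable_past_id _ _ _ _ _ _ y k)).
Qed.

Lemma continuous_sqgrad k : continuous (fun z => sqgrad k z).
Proof.
move=> z.
have c : hnorm dot (grad dot (Phi k) t) @[t --> z] --> hnorm dot (grad dot (Phi k) z).
  exact: (cvg_comp _ _ (grad_continuous H (ltW L0) (Phi_smooth k) (x := z))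
    (hnorm_continuous H (x := _))).
exact: (cvgM c c).
Qed.

(** The expected value of one step, for any affine bound [step] of the expected
    decrease at a fixed point; the next sample is integrated out first. *)
Lemma expectation_step k (A c D : R) : 0 <= A -> 0 <= c -> 0 <= D ->
  (forall z, Phi k z - beta k * (1 - L * beta k / 2) * sqgrad k z
     + L * beta k ^+ 2 / 2 * B <= A * Phi k z + D - c * sqgrad k z) ->
  (\int[P]_w (Phi k (x k.+1 w))%:E + \int[P]_w (c * sqgrad k (x k w))%:E
     <= A%:E * \int[P]_w (Phi k (x k w))%:E + D%:E)%E.
Proof.
move=> A0 c0 D0 step.
pose h (p : past y k * U) := (Phi k (sgd_update p))%:E.
have mh : measurable_fun setT h.
  apply/measurable_EFinP.
  apply: (measurable_continuous_comp _ (sgd_update_measurable (iterate_adapted k))).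
  exact: smooth_continuous (Phi_smooth k).
have h0 p : (0 <= h p)%E by rewrite lee_fin.
pose inner (w : Omega) := (\int[mu]_u h (w, u))%E.
have inner0 w : (0 <= inner w)%E by exact: integral_ge0.
have minner : measurable_fun setT inner.
  have mF : measurable_fun setT (fubini_F mu h).
    exact: measurable_fun_fubini_tonelli_F.
  exact: (measurableT_comp mF (@measurable_past_id _ _ _ _ _ _ y k)).
have mPhi : measurable_fun setT (fun w => (Phi k (x k w))%:E).
  apply/measurable_EFinP; apply: measurable_iterate_comp.
  exact: smooth_continuous (Phi_smooth k).
have msq : measurable_fun setT (fun w => (c * sqgrad k (x k w))%:E).
  apply/measurable_EFinP; apply: measurable_funM => //.
  exact: (measurable_iterate_comp k (@continuous_sqgrad k)).
have -> : (\int[P]_w (Phi k (x k.+1 w))%:E = \int[P]_w inner w)%E.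
  rewrite -(integral_past y_iid mh h0); apply: eq_integral => w _.
  by rewrite /h /sgd_update/= -x_step.
have sq0 w : (0 <= (c * sqgrad k (x k w))%:E)%E.
  by rewrite lee_fin mulr_ge0// sqr_ge0.
rewrite -ge0_integralD//.
apply: (@le_trans _ _ (\int[P]_w (A%:E * (Phi k (x k w))%:E + D%:E))%E).
  apply: ge0_le_integral => //.
  - by move=> w _; rewrite adde_ge0.
  - exact: emeasurable_funD.
  - by apply: emeasurable_funD => //; exact: measurable_funeM.
  - move=> w _; have := expected_descent H (beta k) (Phi_ge0 k) (ltW L0) (Phi_smooth k)
      (G_unbiased k (x k w)) (G_variance k (x k w)).
    rewrite -(sqr_hnorm H) => /(leeD2r (c * sqgrad k (x k w))%:E) hw.
    apply: le_trans hw _; rewrite -EFinM -!EFinD lee_fin.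
    by have := step (x k w); lra.
rewrite ge0_integralD//; last first.
- by apply: measurable_funeM.
- by move=> w _; rewrite mule_ge0// lee_fin.
by rewrite integral_probability_cst ge0_integralZl// => w _; rewrite lee_fin.
Qed.

Local Notation expected k := (\int[P]_w (Phi k (x k w))%:E)%E.

(* [gain k] bounds the increase of the objective from index [k] to [k.+1]. *)
Variable gain : nat -> R.
Hypothesis gain_ge0 : forall k, 0 <= gain k.
Hypothesis Phi_succ : forall k z, Phi k.+1 z <= Phi k z + gain k.

Lemma expected_succ k :
  (expected k.+1 <= \int[P]_w (Phi k (x k.+1 w))%:E + (gain k)%:E)%E.
Proof.
have m j : measurable_fun setT (fun w => (Phi j (x k.+1 w))%:E).
  apply/measurable_EFinP; apply: measurable_iterate_comp.
  exact: smooth_continuous (Phi_smooth j).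
apply: (@le_trans _ _ (\int[P]_w ((Phi k (x k.+1 w))%:E + (gain k)%:E))%E).
  apply: ge0_le_integral => //; first by move=> w _; rewrite lee_fin.
  - by apply: emeasurable_funD.
  - by move=> w _; rewrite -EFinD lee_fin.
by rewrite ge0_integralD// ?integral_probability_cst// => w _; rewrite lee_fin.
Qed.

(** No step makes the expected objective infinite, however large [L * beta k]:
    the squared gradient is at most [2 * L * Phi k]. *)
Lemma expected_fin k : (expected k < +oo)%E.
Proof.
elim: k => [|k IH].
  under eq_integral do rewrite x_init.
  by rewrite integral_probability_cst ltry.
apply: le_lt_trans (expected_succ k) _; apply: lte_add_pinfty; last exact: ltry.
have D0 : 0 <= L * beta k ^+ 2 / 2 * B.
  by rewrite mulr_ge0// divr_ge0// mulr_ge0 ?sqr_ge0// ltW.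
pose A := 1 + L ^+ 2 * beta k ^+ 2.
have A0 : 0 <= A by rewrite addr_ge0// mulr_ge0 ?sqr_ge0.
apply: (@le_lt_trans _ _ (A%:E * expected k + (L * beta k ^+ 2 / 2 * B)%:E)%E).
  have := @expectation_step k A 0 (L * beta k ^+ 2 / 2 * B) A0 (lexx 0) D0.
  under [X in (_ + X)%E]eq_integral do rewrite mul0r.
  rewrite integral0 adde0; apply => z; rewrite mul0r subr0 (sqr_hnorm H).
  have q := grad_bound H z L0 (Phi_ge0 k) (Phi_smooth k).
  have Lb0 : 0 <= L * beta k ^+ 2 / 2.
    by rewrite divr_ge0// mulr_ge0 ?sqr_ge0// ltW.
  have q1 := ler_wpM2l Lb0 q.
  have q2 := mulr_ge0 (ltW (beta_gt0 k)) (dot_ge0 H (grad dot (Phi k) z)).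
  rewrite /A; lra.
apply: lte_add_pinfty; last exact: ltry.
by apply: lte_mul_pinfty.
Qed.

Hypothesis beta_sum : (\sum_(0 <= k <oo) (beta k)%:E = +oo)%E.
Hypothesis beta_sqr_sum : (\sum_(0 <= k <oo) (beta k ^+ 2)%:E < +oo)%E.
Variable M : R.
Hypothesis gain_sum : forall N n, \sum_(0 <= k < n) gain (k + N)%N <= M.

(** Stochastic gradient descent on slowly varying objectives: the expected
    objective telescopes, up to the summable terms [beta k ^+ 2] and [gain k]. *)
Theorem sgd_liminf : {ae P, forall w,
  limn_einf (fun k => (sqgrad k (x k w))%:E) = 0%E}.
Proof.
have [N HN] := summable_sqr_small (divr_gt0 ltr01 L0)
  (fun k => ltW (beta_gt0 k)) beta_sqr_sum.
(* From [N] on, [L * beta k <= 1], so the expected decrease is at least half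
   of [beta k |grad|^2], up to the variance term. *)
pose S k := (\int[P]_w (beta k * sqgrad k (x k w))%:E)%E.
have S0 k : (0 <= S k)%E.
  by apply: integral_ge0 => w _; rewrite lee_fin mulr_ge0// ?sqr_ge0// ltW.
pose C := L / 2 * B.
have C0 : 0 <= C by rewrite mulr_ge0// divr_ge0// ltW.
have mbq k : measurable_fun setT (fun w => beta k * sqgrad k (x k w)).
  apply: measurable_funM => //.
  exact: (measurable_iterate_comp k (@continuous_sqgrad k)).
have bq0 k w : 0 <= beta k * sqgrad k (x k w).
  by rewrite mulr_ge0 ?sqr_ge0// ltW.
have step k : (N <= k)%N ->
  (expected k.+1 + 2^-1%:E * S k <= expected k + (C * beta k ^+ 2 + gain k)%:E)%E.
  move=> Nk; have Lb : L * beta k <= 1.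
    by have := HN k Nk; rewrite ler_pdivlMr// mulrC.
  have bk0 := ltW (beta_gt0 k).
  have := @expectation_step k 1 (beta k / 2) (C * beta k ^+ 2) ler01
    (divr_ge0 bk0 (ler0n R 2)) (mulr_ge0 C0 (sqr_ge0 (beta k))).
  have -> : (\int[P]_w (beta k / 2 * sqgrad k (x k w))%:E = 2^-1%:E * S k)%E.
    rewrite /S -ge0_integralZl//.
    - apply: eq_integral => w _; rewrite -EFinM; congr EFin; ring.
    - exact/measurable_EFinP.
    - by move=> w _; rewrite lee_fin.
  rewrite mul1e => h.
  apply: le_trans (leeD2r _ (expected_succ k)) _.
  rewrite addeAC EFinD addeA; apply: leeD2r; apply: h => z.
  have := mulr_ge0 (mulr_ge0 bk0 (sqr_ge0 (hnorm dot (grad dot (Phi k) z)))).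
  move=> /(_ (1 - L * beta k)); rewrite subr_ge0 => /(_ Lb).
  rewrite /C; lra.
have tele n : (expected (n + N)%N + 2^-1%:E * \sum_(0 <= k < n) S (k + N)%N <=
  expected N + (C * \sum_(0 <= k < n) beta (k + N)%N ^+ 2 +
    \sum_(0 <= k < n) gain (k + N)%N)%:E)%E.
  elim: n => [|n IH]; first by rewrite !big_geq// mule0 mulr0 add0r.
  rewrite !big_nat_recr//= ge0_muleDr ?sume_ge0// addSn.
  set a := (2^-1%:E * \sum_(0 <= k < n) _)%E in IH *.
  rewrite (addeC a) addeA.
  apply: le_trans (leeD2r _ (step _ (leq_addl n N))) _.
  rewrite addeAC; apply: le_trans (leeD2r _ IH) _.
  by rewrite -addeA -EFinD leeD2l// lee_fin mulrDr; lra.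
have Sb : (\sum_(0 <= k <oo) (beta (k + N)%N ^+ 2)%:E < +oo)%E.
  have bb k : (0 <= (beta k ^+ 2)%:E)%E by rewrite lee_fin sqr_ge0.
  rewrite (@nneseries_addn _ (fun k => (beta k ^+ 2)%:E))//.
  apply: le_lt_trans beta_sqr_sum; rewrite [leRHS](@nneseries_split _ _ 0 N)//.
  by rewrite add0n leeDr// sume_ge0.
pose b2 := fine (\sum_(0 <= k <oo) (beta (k + N)%N ^+ 2)%:E)%E.
have b2E n : \sum_(0 <= k < n) beta (k + N)%N ^+ 2 <= b2.
  rewrite -lee_fin fineK; last first.
    rewrite ge0_fin_numE// nneseries_ge0// => k _ _.
    by rewrite lee_fin sqr_ge0.
  rewrite -sumEFin; apply: (@nneseries_lim_ge _ _ xpredT) => k _ _.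
  by rewrite lee_fin sqr_ge0.
pose T := (expected N + (C * b2 + M)%:E)%E.
have Too : (T < +oo)%E by apply: lte_add_pinfty; [exact: expected_fin|exact: ltry].
have part n : (\sum_(0 <= k < n) (2^-1%:E * S (k + N)%N) <= T)%E.
  rewrite -ge0_sume_distrr//.
  apply: (@le_trans _ _ (expected (n + N)%N + 2^-1%:E * \sum_(0 <= k < n) S (k + N)%N)%E).
    by rewrite leeDr// integral_ge0// => w _; rewrite lee_fin.
  apply: le_trans (tele n) _; rewrite leeD2l// lee_fin lerD//.
  by rewrite ler_wpM2l.
have Ssum : (\sum_(0 <= k <oo) S (k + N)%N < +oo)%E.
  have hS : (\sum_(0 <= k <oo) (2^-1%:E * S (k + N)%N) <= T)%E.
    apply: lime_le; last by apply: nearW => n; exact: part.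
    by apply: is_cvg_nneseries => k _ _; rewrite mule_ge0.
  rewrite nneseriesZl// in hS.
  rewrite ltey; apply/eqP => Soo; move: hS; rewrite Soo gt0_muley ?lte_fin//.
  by rewrite leNgt Too.
have := @ae_summable _ _ _ P
  (fun k w => beta (k + N)%N * sqgrad (k + N)%N (x (k + N)%N w)).
move=> /(_ (fun k => mbq (k + N)%N) (fun k w => bq0 (k + N)%N w) Ssum).
apply: filterS => w ws.
by apply: (limn_einf_eq0 (beta := beta) (N := N)) => // k; exact: sqr_ge0.
Qed.

End StochasticGradientDescent.

(** * The penalized objective *)

Section PenalizedObjective.
Context {R : realType} {V : normedModType R} (dot : V -> V -> R).
Hypothesis H : hilbert_dot dot.
Context {dU : measure_display} {U : measurableType dU} (mu : probability U R).
Variables f g : V -> U -> R.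
Hypothesis f_regular : regular dot mu f.
Hypothesis g_regular : regular dot mu g.

Lemma mean_ge0 h : regular dot mu h -> forall x, 0 <= mean mu h x.
Proof. by move=> [h0 _ _ _ _] x; apply: Rintegral_ge0. Qed.

Lemma PsiE l x : Psi mu f g l x = mean mu f x + l * mean mu g x.
Proof.
have [_ _ fi _ _] := f_regular; have [_ _ gi _ _] := g_regular.
have lgi : mu.-integrable setT (EFin \o (fun u => l * g x u)).
  exact: eq_integrable (integrableZl measurableT l (gi x)).
by rewrite /Psi /mean /penalized RintegralD// RintegralZl.
Qed.

Lemma Psi_ge0 l x : 0 <= l -> 0 <= Psi mu f g l x.
Proof.
move=> l0; rewrite PsiE addr_ge0// ?mulr_ge0//.
  exact: mean_ge0 f_regular x.
exact: mean_ge0 g_regular x.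
Qed.

Lemma smooth_Psi L1 L2 l : 0 <= l -> smooth dot L1 (mean mu f) ->
  smooth dot L2 (mean mu g) -> smooth dot (L1 + l * L2) (Psi mu f g l).
Proof.
move=> l0 sf sg.
have -> : Psi mu f g l = (fun x => mean mu f x + l * mean mu g x).
  by apply/funext => x; exact: PsiE.
exact: smoothDZ.
Qed.

Lemma xgrad_penalized l x u : xgrad dot (penalized f g l) x u =
  xgrad dot f x u + l *: xgrad dot g x u.
Proof.
have [_ fd _ _ _] := f_regular; have [_ gd _ _ _] := g_regular.
exact: gradDZ.
Qed.

Lemma superposition_penalized l :
  superposition_measurable (xgrad dot (penalized f g l)).
Proof.
have [_ _ _ fm _] := f_regular; have [_ _ _ gm _] := g_regular.
move=> d T xi mxi.
have := strongly_measurableDZ l (fm _ _ _ mxi) (gm _ _ _ mxi).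
by under [X in _ -> strongly_measurable X]eq_fun do rewrite xgrad_penalized.
Qed.

Lemma bochner_penalized l x :
  differentiable (mean mu f) x -> differentiable (mean mu g) x ->
  is_bochner_integral mu (xgrad dot (penalized f g l) x)
    (grad dot (Psi mu f g l) x).
Proof.
have [_ _ _ _ fb] := f_regular; have [_ _ _ _ gb] := g_regular.
move=> df dg.
have -> : Psi mu f g l = (fun x => mean mu f x + l * mean mu g x).
  by apply/funext => z; exact: PsiE.
rewrite (gradDZ H)//.
have -> : xgrad dot (penalized f g l) x =
    (fun u => xgrad dot f x u + l *: xgrad dot g x u).
  by apply/funext => u; exact: xgrad_penalized.
exact: (is_bochner_integralDZ H).
Qed.

End PenalizedObjective.

Unset Implicit Arguments.

Theorem theorem6p6 (R : realType)
  (Z : completeNormedModType R) (ip : {dot Z for idfun})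
  (ip_norm : induces_norm ip) (d : nat)
  (dU : measure_display) (U : measurableType dU) (mu : probability U R)
  (dO : measure_display) (Omega : measurableType dO) (P : probability Omega R)
  (f g : Z * 'rV[R]_d -> U -> R)
  (f_regular : regular (prod_dot ip (d := d)) mu f)
  (g_regular : regular (prod_dot ip (d := d)) mu g)
  (lambda_bar : R) (lambda_bar_gt0 : 0 < lambda_bar)
  (beta : nat -> R) (beta_gt0 : forall k, 0 < beta k)
  (lambda : nat -> R) (lambda_gt0 : forall k, 0 < lambda k)
  (lambda_incr : nondecreasing_seq lambda)
  (y : nat -> {RV P >-> U}) (y_iid : iid_samples mu y)
  (x0 : Z * 'rV[R]_d) (x : nat -> Omega -> Z * 'rV[R]_d)
  (x_init : forall w, x 0%N w = x0)
  (x_step : forall k w, x k.+1 w =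
     x k w - beta k *: xgrad (prod_dot ip (d := d)) (penalized f g (lambda k))
                             (x k w) (y k w))
  (a : R) (a_gt0 : 0 < a) (g_bounded : forall x, mean mu g x <= a)
  (L1 L2 : R) (L1_gt0 : 0 < L1) (L2_gt0 : 0 < L2)
  (f_smooth : smooth (prod_dot ip (d := d)) L1 (mean mu f))
  (g_smooth : smooth (prod_dot ip (d := d)) L2 (mean mu g))
  (lambda_dist : nonincreasing_seq (fun k => `|lambda k - lambda_bar| ^+ 2))
  (beta_small : forall k, beta k < 1 / (L1 + lambda k ^+ 2 * L2))
  (beta_sum : (\sum_(0 <= k <oo) (beta k)%:E = +oo)%E)
  (beta_sqr_sum : (\sum_(0 <= k <oo) (beta k ^+ 2)%:E < +oo)%E)
  (b1 b2 : R) (b1_gt0 : 0 < b1) (b2_gt0 : 0 < b2)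
  (variance_bounded : forall k x,
     (gradient_variance (prod_dot ip (d := d)) mu (penalized f g (lambda k)) x
        <= (b1 + b2 * lambda k ^+ 2)%:E)%E) :
  {ae P, forall w,
    limn_einf (fun k =>
      (hnorm (prod_dot ip (d := d))
         (grad (prod_dot ip (d := d)) (Psi mu f g (lambda k)) (x k w)) ^+ 2)%:E)
    = 0%E}.
Proof.
have H := prod_dot_hilbert ip_norm d.
(* By monotonicity of the distance to [lambda_bar], the penalties are bounded, so
   one smoothness constant and one variance bound serve for all [k]. *)
pose Lam := `|lambda_bar| + `|lambda 0%N - lambda_bar|.
have lamLam k : lambda k <= Lam := nonincreasing_dist_bounded lambda_dist k.
have lam0 k : 0 <= lambda k by exact: ltW.
have Lam0 : 0 <= Lam by exact: le_trans (lam0 0%N) (lamLam 0%N).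
(* Raising the penalty adds at most [(lambda k.+1 - lambda k) * a]. *)
pose gain k := (lambda k.+1 - lambda k) * a.
have gain0 k : 0 <= gain k.
  by rewrite mulr_ge0 ?(ltW a_gt0)// subr_ge0; exact: lambda_incr.
have gain_sum N n : \sum_(0 <= k < n) gain (k + N)%N <= Lam * a.
  rewrite -mulr_suml ler_wpM2r ?(ltW a_gt0)//.
  rewrite (eq_bigr (fun k => lambda (k.+1 + N)%N - lambda (k + N)%N))//.
  rewrite (telescope_sumr (fun k => lambda (k + N)%N))//.
  by apply: le_trans (lamLam (n + N)%N); rewrite gerBl.
apply: (sgd_liminf H y_iid (beta := beta) (L := L1 + Lam * L2)
  (B := b1 + b2 * Lam ^+ 2)
  (G := fun k => xgrad (prod_dot ip (d := d)) (penalized f g (lambda k)))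
  (Phi := fun k => Psi mu f g (lambda k)) _ _ beta_gt0 _ _ _ _ _ x_init x_step
  gain0 _ beta_sum beta_sqr_sum gain_sum).
- by move=> k; apply: (superposition_penalized H f_regular g_regular).
- by move=> k z; exact: (Psi_ge0 f_regular g_regular).
- by rewrite ltr_pwDl// mulr_ge0// ltW.
- by rewrite addr_ge0 ?mulr_ge0 ?sqr_ge0// ltW.
- move=> k; apply: smooth_le
    (smooth_Psi H f_regular g_regular (lam0 k) f_smooth g_smooth).
  by rewrite lerD2l ler_wpM2r ?(ltW L2_gt0).
- move=> k z.
  by apply: (bochner_penalized H f_regular g_regular); [case: f_smooth|case: g_smooth].
- move=> k z; have bk := bochner_penalized H f_regular g_regular (lambda k)
    (proj1 f_smooth z) (proj1 g_smooth z).
  have := variance_bounded k z; rewrite /gradient_variance (bochner_integralE H bk).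
  move=> /le_trans; apply; rewrite lee_fin lerD2l ler_wpM2l ?(ltW b2_gt0)//.
  by rewrite ler_pXn2r ?nnegrE.
- move=> k z; rewrite !(PsiE f_regular g_regular) -addrA lerD2l addrC -lerBlDr -mulrBl.
  by rewrite ler_wpM2l// subr_ge0; exact: lambda_incr.
Qed.
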